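(* The sets $\mathcal{X}$ and $\mathcal{Y}_1$ are infinite subsets of $N_1$, and $\mathcal{Y}_2$ and $\mathcal{Y}_3$ are non-empty subsets of $N_1$.
   Context: $\phi$ is Euler's totient function, $V$ its image; for $m\in V$, $N_1(m)=\max\{x\in\mathbb{N}:\phi(x)\le m\}$, $N_1=\{N_1(m):m\in V\}$. $\mathbb{P}$ is the set of primes; all products over $q$ are over primes $q$; $\mathcal{O}_p=\{q\in\mathbb{P}: q>p\}$. For a prime $p$, $p_i$ denotes the $i$th smallest prime greater than $p$. For $n\in\mathbb{N}$, $p\in\mathbb{P}$, $k\in\mathbb{N}$: $X_{n,p}=\left(n\prod_{q\mid n}q^{-1}\right)\prod_{q\le p}q$, $Y_{p,k}=\prod_{q\le p_k,\,q\ne p}q$, $D(p)=\frac{(p_1-p)(p_2-p)}{p(p-1)}$, $A(p)=\frac{p_1p_2}{p}$. $E(2)=\{p\in\mathbb{P}: (A(p),A(p)+D(p)]\cap\mathbb{P}=\varnothing\}$; $E(3)=\{p\in\mathbb{P}: \left(\frac{p_1p_2p_3}{pq}, 1+\frac{(p_1-1)(p_2-1)(p_3-1)}{(p-1)(q-1)}\right]\cap\mathcal{O}_q=\varnothing \text{ for all } q\in\mathcal{O}_p\}$. $\mathcal{X}=\{X_{n,p}: n\in\mathbb{N},\ p\in\mathbb{P},\ p>n/2\}$, $\mathcal{Y}_1=\{Y_{p,1}: p\in\mathbb{P},\ p\ge5\}$, $\mathcal{Y}_2=\{Y_{p,2}: p\in E(2),\ p\ge 11\}$, $\mathcal{Y}_3=\{Y_{p,3}: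 p\in E(3),\ p\ge11\}$. *)

(* Defs.v *)
From mathcomp Require Import all_boot all_order all_algebra.
From mathcomp Require Import all_classical.

Set Implicit Arguments.
Unset Strict Implicit.
Unset Printing Implicit Defensive.

Import Order.TTheory GRing.Theory Num.Theory.

Local Open Scope classical_set_scope.
Local Open Scope nat_scope.

(* The natural numbers of the source are positive, whence the explicit
   positivity conditions below (totient 0 = 0 in MathComp). *)

Definition V : set nat := [set m | exists2 x, 0 < x & totient x = m].

Definition is_N1 (m x : nat) : Prop :=
  [/\ 0 < x, totient x <= m & forall y, 0 < y -> totient y <= m -> y <= x].

Definition N1 : set nat := [set x | exists2 m, V m & is_N1 m x].

Lemma exists_prime_gt (p : nat) : exists q, (p < q) && prime q.
Proof. by have [q pq q_pr] := prime_above p; exists q; rewrite pq. Qed.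

Definition next_prime (p : nat) : nat := ex_minn (exists_prime_gt p).

(* p_i, the i-th smallest prime greater than p; see prime_afterP *)
Definition prime_after (p i : nat) : nat := iter i next_prime p.

Lemma next_primeP (p : nat) :
  [/\ p < next_prime p, prime (next_prime p)
    & forall q, prime q -> p < q -> next_prime p <= q].
Proof.
rewrite /next_prime; case: ex_minnP => q /andP[pq q_pr] qmin.
by split=> // r r_pr pr; apply: qmin; rewrite pr.
Qed.

Lemma prime_afterP (p i : nat) : 0 < i ->
  [/\ p < prime_after p i, prime (prime_after p i)
    & count (fun q => (p < q) && prime q) (iota 0 (prime_after p i).+1) = i].
Proof.
pose c n := count (fun q => (p < q) && prime q) (iota 0 n.+1).
have cP m : p <= m -> c (next_prime m) = (c m).+1.
  move=> pm; have [m_lt np_pr np_min] := next_primeP m.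
  have -> : c (next_prime m) = c m
      + count (fun q => (p < q) && prime q) (iota m.+1 (next_prime m - m.+1))
      + 1.
    rewrite /c (_ : (next_prime m).+1 = m.+1 + (next_prime m - m.+1) + 1).
      rewrite iotaD count_cat iotaD count_cat !add0n subnKC //= np_pr.
      by rewrite (leq_ltn_trans pm m_lt).
    by rewrite subnKC // addn1.
  rewrite [count _ (iota m.+1 _)](_ : _ = 0) ?addn0 ?addn1 //.
  apply/eqP; rewrite eqn0Ngt -has_count; apply/hasPn => q.
  rewrite mem_iota subnKC // => /andP[mq q_lt].
  apply/negP => /andP[_ q_pr].
  by have := np_min q q_pr mq; rewrite leqNgt q_lt.
have c0 : c p = 0.
  apply/eqP; rewrite eqn0Ngt -has_count; apply/hasPn => q.
  by rewrite mem_iota add0n ltnS /= => qp; rewrite ltnNge qp.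
have H j : p <= prime_after p j /\ c (prime_after p j) = j.
  elim: j => [|j [IH1 IH2]]; first by rewrite /prime_after.
  rewrite /prime_after iterS -/(prime_after p j) cP // IH2; split=> //.
  have [lt_np _ _] := next_primeP (prime_after p j).
  exact: leq_trans IH1 (ltnW lt_np).
case: i => // i _; split; last by have [] := H i.+1.
- rewrite /prime_after iterS -/(prime_after p i).
  have [lt_np _ _] := next_primeP (prime_after p i); have [le_p _] := H i.
  exact: leq_ltn_trans le_p lt_np.
- rewrite /prime_after iterS -/(prime_after p i).
  by have [] := next_primeP (prime_after p i).
Qed.

Lemma prod_primes_dvd (n : nat) : 0 < n -> \prod_(q <- primes n) q %| n.
Proof.
move=> n_gt0; rewrite {2}(prod_prime_decomp n_gt0) prime_decompE big_map /=.
rewrite big_seq [X in _ %| X]big_seq.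
apply: (big_ind2 (fun a b => a %| b)) => //.
- by move=> a b c d; apply: dvdn_mul.
- by move=> q q_n; rewrite dvdn_exp // logn_gt0.
Qed.

(* The division is exact for n > 0 by prod_primes_dvd. *)
Definition X (n p : nat) : nat :=
  n %/ (\prod_(q <- primes n) q) * \prod_(q < p.+1 | prime q) q.

Definition Y (p k : nat) : nat :=
  \prod_(q < (prime_after p k).+1 | prime q && (q != p :> nat)) q.

Definition primes_gt (p : nat) : set nat := [set q | prime q /\ p < q].

Local Open Scope ring_scope.

Definition D (p : nat) : rat :=
  ((prime_after p 1)%:R - p%:R) * ((prime_after p 2)%:R - p%:R)
    / (p%:R * (p%:R - 1)).

Definition A (p : nat) : rat :=
  (prime_after p 1)%:R * (prime_after p 2)%:R / p%:R.

(* the natural numbers in the half-open interval (a, b] *)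
Definition nat_itv_oc (a b : rat) : set nat := [set r : nat | a < r%:R <= b].

Definition E2 : set nat :=
  [set p : nat | prime p
    /\ nat_itv_oc (A p) (A p + D p) `&` [set r | prime r] = set0].

Definition E3_lower (p q : nat) : rat :=
  (prime_after p 1)%:R * (prime_after p 2)%:R * (prime_after p 3)%:R
    / (p%:R * q%:R).

Definition E3_upper (p q : nat) : rat :=
  1 + ((prime_after p 1)%:R - 1) * ((prime_after p 2)%:R - 1)
        * ((prime_after p 3)%:R - 1)
      / ((p%:R - 1) * (q%:R - 1)).

Definition E3 : set nat :=
  [set p : nat | prime p /\ forall q, primes_gt p q ->
     nat_itv_oc (E3_lower p q) (E3_upper p q) `&` primes_gt q = set0].

Local Close Scope ring_scope.

(* p > n / 2 (real division) is n < 2 * p. *)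
Definition calX : set nat :=
  [set x | exists n p, [/\ 0 < n, prime p, n < 2 * p & x = X n p]].

Definition calY1 : set nat :=
  [set y | exists p, [/\ prime p, 5 <= p & y = Y p 1]].

Definition calY2 : set nat :=
  [set y | exists p, [/\ E2 p, 11 <= p & y = Y p 2]].

Definition calY3 : set nat :=
  [set y | exists p, [/\ E3 p, 11 <= p & y = Y p 3]].

(* Main.v *)
Require Import Defs.
From mathcomp Require Import all_boot all_order all_algebra.
From mathcomp Require Import all_classical.
From mathcomp Require Import zify ring.

Set Implicit Arguments.
Unset Strict Implicit.
Unset Printing Implicit Defensive.

Import Order.TTheory GRing.Theory Num.Theory.

Local Open Scope classical_set_scope.
Local Open Scope nat_scope.

(**
  It suffices that phi y > phi x for all y > x. Let S be the set of primes
  dividing y and write y = t h(S), phi y = t g(S), with h(S) and g(S) the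
  products of the q and of the q - 1 for q in S. If y > x and phi y <= phi x,
  then phi y is small while y / phi y, the product of the q / (q - 1), is large;
  comparing S with an initial segment of the primes bounds the size of S from
  above by the first fact and from below by the second. For X_{n,p} the two
  bounds are incompatible. For Y_{p,k} with p_k < 2p - 1 they force t = 1 and
  S = {primes <= p} together with k - 1 larger primes, which for k = 2, 3 is
  exactly what E(2) and E(3) exclude. The inequalities p_1 < 2p - 1 (p >= 5) and
  p_3 < 2p - 1 (p >= 11) come from Erdos' proof of Bertrand's postulate, which
  gives four primes in (n, 2n] as soon as n >= 800. Finally 11 lies in both E(2)
  and E(3).
*)

(** * Primes between n and 2n *)

Lemma prime_dvd_fact (p n : nat) : prime p -> (p %| n`!) = (p <= n).
Proof.
move=> p_pr; elim: n => [|n IHn].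
  by rewrite fact0 Euclid_dvd1 // leqNgt prime_gt0.
rewrite factS Euclid_dvdM // IHn; apply/orP/idP => [[/dvdn_leq->|/leqW]|] //.
by rewrite leq_eqVlt ltnS => /orP[/eqP->|]; [left|right].
Qed.

Lemma prod_primes_dvd_of (r : seq nat) (m : nat) :
  uniq r -> {in r, forall q, prime q && (q %| m)} -> \prod_(q <- r) q %| m.
Proof.
elim: r => [|q r IHr] /=; first by rewrite big_nil dvd1n.
case/andP=> qr ur hr; rewrite big_cons Gauss_dvd.
  have /andP[_ ->] := hr q (mem_head _ _).
  by apply: IHr => // x xr; apply: hr; rewrite in_cons xr orbT.
have /andP[q_pr _] := hr q (mem_head _ _).
rewrite prime_coprime // Euclid_dvd_prod // big_has.
apply/negP => /hasP[x xr /= qx].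
have /andP[x_pr _] : prime x && (x %| m) by apply: hr; rewrite in_cons xr orbT.
by move: qx; rewrite dvdn_prime2 // => /eqP qx; rewrite qx xr in qr.
Qed.

(** The two middle terms of (1 + 1)^(2k+1) are equal and together amount to at most 2 * 4^k. *)
Lemma bin_odd_le (k : nat) : 'C(k.*2.+1, k) <= 4 ^ k.
Proof.
have : 'C(k.*2.+1, k) + 'C(k.*2.+1, k.+1) <= 2 ^ k.*2.+1.
  rewrite (_ : 2 ^ _ = (1 + 1) ^ k.*2.+1) // expnDn.
  under eq_bigr do rewrite !exp1n !muln1.
  have hk : k < k.*2.+2 by lia.
  have hk1 : k.+1 < k.*2.+2 by lia.
  rewrite (bigD1 (Ordinal hk)) //= (bigD1 (Ordinal hk1)) //=; first by lia.
  by rewrite -val_eqE /=; lia.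
have -> : 'C(k.*2.+1, k.+1) = 'C(k.*2.+1, k).
  by rewrite -bin_sub; [congr 'C(_, _)|]; lia.
have -> : 2 ^ k.*2.+1 = 2 * 4 ^ k by rewrite expnS -mul2n expnM.
lia.
Qed.

(** Strong induction: an even m > 2 adds no prime, and for m = 2k + 1 the primes in (k + 1, 2k + 1]
    all divide C(2k+1, k), which is at most 4^k. *)
Lemma primorial_le (m : nat) : \prod_(0 <= q < m.+1 | prime q) q <= 4 ^ m.
Proof.
elim/ltn_ind: m => m IHm.
case: (posnP m) => [->|m_gt0]; first by rewrite big_mkcond big_nat1.
case: (leqP m 2) => [m2|m_gt2].
  have [->|->] : m = 1 \/ m = 2 by lia.
    by rewrite unlock.
  by rewrite unlock.
have [m_odd|m_even] := boolP (odd m); last first.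
  rewrite big_mkcond big_nat_recr //= -big_mkcond /=.
  have -> : prime m = false.
    by apply/negP => /even_prime[]; [lia | rewrite (negPf m_even)].
  rewrite muln1; case: m IHm m_gt0 m_gt2 m_even => // m IHm *.
  by apply: leq_trans (IHm m _) _ => //; rewrite leq_exp2l.
pose k := m./2; have mE : m = k.*2.+1 by rewrite -[LHS]odd_double_half m_odd.
rewrite (@big_cat_nat _ _ _ k.+2) //=; last by lia.
have -> : 4 ^ m = 4 ^ k.+1 * 4 ^ k by rewrite -expnD; congr (_ ^ _); lia.
apply: leq_mul; first by apply: IHm; lia.
apply: leq_trans (bin_odd_le k); apply: dvdn_leq; first by rewrite bin_gt0; lia.
rewrite -big_filter; apply: prod_primes_dvd_of.
  by rewrite filter_uniq // iota_uniq.
move=> q; rewrite mem_filter mem_index_iota => /andP[q_pr /andP[kq qm]].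
(* The prime [q] divides (2k+1)! but neither k! nor (k+1)!, hence it divides the binomial. *)
rewrite q_pr /=; have := @bin_fact k.*2.+1 k ltac:(lia).
move=> /(congr1 (dvdn q)); rewrite (prime_dvd_fact k.*2.+1) // !Euclid_dvdM //.
rewrite !prime_dvd_fact //.
have -> : q <= k.*2.+1 by lia.
have -> : (q <= k) = false by lia.
have -> : (q <= k.*2.+1 - k) = false by lia.
by rewrite !orbF.
Qed.

(** Induction through (n + 1) C(2n+2, n+1) = 2 (2n + 1) C(2n, n). *)
Lemma central_bin_lower (n : nat) : 0 < n -> 4 ^ n <= n.*2 * 'C(n.*2, n).
Proof.
elim: n => // n IHn _; case: (posnP n) => [->//|n_gt0].
have /= E1 := mul_bin_diag n.*2.+1 n.
have E2 : 'C(n.*2.+1, n) = 'C(n.*2.+1, n.+1).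
  by rewrite -[RHS]bin_sub; [congr 'C(_, _)|]; lia.
rewrite expnS doubleS binS E2.
have := IHn n_gt0; move: E1; rewrite -!mul2n; clear.
move: 'C(_, _) 'C(_, _) (4 ^ n) => a b c; nia.
Qed.

(** Legendre's formula for (2n)! = C(2n, n) n!^2, stated additively to avoid truncated subtraction;
    the sum for n! is extended to 2n by zero terms. *)
Lemma logn_central_bin (p n : nat) : prime p ->
  logn p 'C(n.*2, n) + \sum_(1 <= k < n.*2.+1) (n %/ p ^ k).*2
    = \sum_(1 <= k < n.*2.+1) n.*2 %/ p ^ k.
Proof.
move=> p_pr; have le_n : n <= n.*2 by lia.
have := bin_fact le_n; rewrite (_ : n.*2 - n = n); last by lia.
move=> /(congr1 (logn p)); rewrite !lognM ?muln_gt0 ?fact_gt0 ?bin_gt0 //.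
rewrite !logn_fact // => <-; rewrite addnn; congr (_ + _).
transitivity (\sum_(1 <= k < n.*2.+1) n %/ p ^ k).*2.
  by rewrite -[RHS]mul2n big_distrr /=; apply: eq_bigr => i _; rewrite mul2n.
congr (_.*2); rewrite (@big_cat_nat _ _ _ n.+1) //= ?ltnS //.
rewrite [X in _ + X]big_nat_cond [X in _ + X]big1 ?addn0 // => i.
case/andP=> /andP[ni _] _.
rewrite divn_small // (leq_trans _ (ltnW (ltn_expl i (prime_gt1 p_pr)))) //.
Qed.

(** Each floor(2n / p^k) - 2 floor(n / p^k) is at most 1, and it is 0 once p^k > 2n; so the exponent
    is at most the integer logarithm of 2n in base p. *)
Lemma expn_logn_central_bin (p n : nat) : prime p -> 0 < n ->
  p ^ logn p 'C(n.*2, n) <= n.*2.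
Proof.
move=> p_pr n_gt0; have p_gt1 := prime_gt1 p_pr.
have n2_gt0 : 0 < n.*2 by lia.
set L := trunc_log p n.*2.
apply: leq_trans (trunc_logP p_gt1 n2_gt0); rewrite leq_pexp2l ?prime_gt0 //.
rewrite -(leq_add2r (\sum_(1 <= k < n.*2.+1) (n %/ p ^ k).*2)).
rewrite logn_central_bin // -/L.
have le_L : L <= n.*2.
  have := trunc_logP p_gt1 n2_gt0; have := ltn_expl L p_gt1.
  by rewrite -/L; lia.
have {1}-> : L = \sum_(1 <= k < n.*2.+1) (k <= L).
  rewrite (@big_cat_nat _ _ _ L.+1) //=.
  rewrite [X in _ + X]big_nat_cond [X in _ + X]big1.
    rewrite (eq_big_nat _ _ (F2 := fun=> 1)).
      by rewrite sum_nat_const_nat muln1 addn0; lia.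
    by move=> i; rewrite ltnS => /andP[_ ->].
  by move=> i; rewrite andbT => /andP[Li _]; rewrite leqNgt Li.
rewrite -big_split /=; apply: leq_sum => k _.
have [kL|Lk] := leqP k L.
  rewrite -ltnS ltn_divLR ?expn_gt0 ?prime_gt0 //.
  have := divn_eq n (p ^ k).
  have : n %% p ^ k < p ^ k by rewrite ltn_mod expn_gt0 prime_gt0.
  move: (p ^ k) => c; move: (n %/ c) (n %% c) => a b /=; nia.
rewrite divn_small //; apply: leq_trans (trunc_log_ltn _ p_gt1) _.
by rewrite leq_exp2l.
Qed.

(** Here floor(2n / p) = 2 and floor(n / p) = 1, and all higher powers of p exceed 2n. *)
Lemma logn_central_bin0 (p n : nat) : prime p -> n.*2 < 3 * p -> p <= n ->
  n.*2 < p ^ 2 -> logn p 'C(n.*2, n) = 0.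
Proof.
move=> p_pr n3p pn np2; have p_gt0 := prime_gt0 p_pr.
have := logn_central_bin n p_pr.
rewrite (eq_big_nat _ _ (F2 := fun k => n.*2 %/ p ^ k)); first by lia.
move=> [//|[|k]] _.
  rewrite expn1 (_ : n %/ p = 1).
    apply/eqP; rewrite eqn_leq leq_divRL // -[_ %/ p <= _]ltnS ltn_divLR //.
    by lia.
  apply/eqP; rewrite eqn_leq leq_divRL // -[_ %/ p <= _]ltnS ltn_divLR //.
  by lia.
have le_p2 : p ^ 2 <= p ^ k.+2 by rewrite leq_pexp2l.
rewrite !divn_small //; first exact: leq_trans np2 le_p2.
by apply: leq_trans _ le_p2; lia.
Qed.

Lemma central_bin_factor (n : nat) :
  'C(n.*2, n) = \prod_(0 <= p < n.*2.+1 | prime p) p ^ logn p 'C(n.*2, n).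
Proof.
have C_gt0 : 0 < 'C(n.*2, n) by rewrite bin_gt0; lia.
set c := 'C(n.*2, n) in C_gt0 *.
rewrite -{1}(partnT C_gt0) (widen_partn predT (leq_addr n.*2 c)).
rewrite (@big_cat_nat _ _ _ n.*2.+1) //=; last by lia.
rewrite [X in _ * X]big_nat_cond [X in _ * X]big1 ?muln1.
  rewrite [RHS]big_mkcond; apply: eq_bigr => p _.
  by case: ifPn => // /negbTE np; rewrite lognE np.
move=> p /andP[/andP[np _] _]; rewrite lognE; case: ifP => // /and3P[p_pr _ pc].
have le_n : n <= n.*2 by lia.
have : p %| n.*2`! by rewrite -(bin_fact le_n) dvdn_mulr.
by rewrite prime_dvd_fact // leqNgt np.
Qed.

Lemma prod_count (I : Type) (r : seq I) (P : pred I) (b : nat) :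
  \prod_(i <- r | P i) b = b ^ count P r.
Proof. by rewrite big_const_seq iter_muln_1. Qed.

(* Primes p with 2n/3 < p <= n do not divide the central binomial, and those
   with p^2 > 2n divide it at most once. *)
Lemma central_bin_upper (n s : nat) : 2 < s -> n.*2 < s.+1 ^ 2 -> 0 < n ->
  'C(n.*2, n) <=
    n.*2 ^ s * 4 ^ (n.*2 %/ 3) * n.*2 ^ count prime (index_iota n.+1 n.*2.+1).
Proof.
move=> s_gt2 ns n_gt0; rewrite central_bin_factor.
have le_n : n <= n.*2 by lia.
(* The power of p in the binomial is at most 2n if p <= s or p > n, at most p if s < p <= 2n/3, and
   1 in between. The products of [g1], [g2] and [g3] give the three factors of the bound. *)
pose g1 p := if p <= s then n.*2 else 1.
pose g2 p := if p <= n.*2 %/ 3 then p else 1.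
pose g3 p := if n < p then n.*2 else 1.
have g_le : \prod_(0 <= p < n.*2.+1 | prime p) p ^ logn p 'C(n.*2, n)
    <= \prod_(0 <= p < n.*2.+1 | prime p) (g1 p * g2 p * g3 p).
  apply: leq_prod => p p_pr; rewrite /g1 /g2 /g3.
  have p_gt0 := prime_gt0 p_pr.
  have pC := expn_logn_central_bin p_pr n_gt0.
  have [ps|sp] := leqP p s.
    rewrite -mulnA; apply: leq_trans pC _; apply: leq_pmulr.
    by rewrite muln_gt0; case: ifP; case: ifP; lia.
  rewrite mul1n; have np2 : n.*2 < p ^ 2.
    by apply: leq_trans ns _; rewrite leq_exp2r.
  have [np|pn] := ltnP n p.
    by apply: leq_trans pC _; apply: leq_pmull; case: ifP.
  rewrite muln1; have [_|p3] := leqP p (n.*2 %/ 3); last first.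
    by rewrite logn_central_bin0 //; lia.
  rewrite -[X in _ <= X]expn1 leq_pexp2l // leqNgt; apply/negP => log2.
  have : p ^ 2 <= p ^ logn p 'C(n.*2, n) by rewrite leq_pexp2l.
  by rewrite leqNgt (leq_ltn_trans pC np2).
apply: leq_trans g_le _; rewrite !big_split /=.
apply: leq_mul; first apply: leq_mul.
- rewrite -big_mkcondr /= prod_count leq_pexp2l //; first by lia.
  rewrite -size_filter.
  have sub : {subset [seq p <- index_iota 0 n.*2.+1 | prime p && (p <= s)]
      <= iota 1 s}.
    move=> p; rewrite mem_filter mem_iota => /andP[/andP[/prime_gt0 ? ?] _].
    lia.
  rewrite -[X in _ <= X](size_iota 1) uniq_leq_size //.
  by rewrite filter_uniq // iota_uniq.
- apply: leq_trans (primorial_le _); rewrite -big_mkcondr /=.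
  have le3 : (n.*2 %/ 3).+1 <= n.*2.+1 by lia.
  rewrite (@big_cat_nat _ _ _ _ _ _ _ _ _ le3) //= [X in _ * X]big_nat_cond.
  rewrite [X in _ * X]big1 ?muln1; last first.
    by move=> p /andP[/andP[? _] /andP[_]]; lia.
  rewrite big_nat_cond [X in _ <= X]big_nat_cond.
  rewrite (eq_bigl (fun p => (0 <= p < (n.*2 %/ 3).+1) && prime p)) // => p.
  by case: prime; rewrite ?andbF //= ltnS andbb ?andbT.
rewrite -big_mkcondr /= prod_count leq_pexp2l //; first by lia.
rewrite /index_iota subn0 subSS -!size_filter.
apply: uniq_leq_size => [|p]; first by rewrite filter_uniq // iota_uniq.
rewrite !mem_filter !mem_iota => /andP[/andP[-> ?] ?] /=; lia.
Qed.

(** The growth comparison that closes the Bertrand argument, with s the integer square root of 2n;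
    40 matches n >= 800 because 40^2 = 2 * 800. The base case is 41^6 < 64^6 = 2^36. *)
Lemma pow6_lt_pow2 (s : nat) : 40 <= s -> s.+1 ^ 6 < 2 ^ (s - 4).
Proof.
move=> /subnK <-; elim: (s - 40) => [|m IHm].
  by rewrite (expnM 2 6 6 : 2 ^ (0 + 40 - 4) = _) ltn_exp2r.
rewrite addSn subSn ?expnS; last by lia.
set a := (m + 40).+1 in IHm *.
have : a.+1 ^ 6 <= 2 * a ^ 6.
  have a40 : 40 < a by lia.
  rewrite !expnS !expn0 !muln1; nia.
by rewrite expnS; lia.
Qed.

Lemma sqrtn_exists (m : nat) : exists2 s, s ^ 2 <= m & m < s.+1 ^ 2.
Proof.
elim: m => [|m [s s_le s_lt]]; first by exists 0.
have [s1|s1] := leqP (s.+1 ^ 2) m.+1.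
  by exists s.+1 => //; apply: leq_ltn_trans s_lt _; rewrite ltn_exp2r.
by exists s => //; apply: leq_trans s_le _.
Qed.

(** With at most three primes in (n, 2n], the two bounds on C(2n, n) give 4^n <= (2n)^(s+4)
    4^(2n/3). Cubing yields 4^n <= (2n)^(3(s+4)) <= (s+1)^(6(s+4)) < 2^(s^2-16) <= 4^n, a
    contradiction. *)
Lemma four_primes_lt_double (n : nat) : 800 <= n ->
  3 < count prime (index_iota n.+1 n.*2.+1).
Proof.
move=> n_ge; rewrite ltnNge; apply/negP => count_le3.
have n_gt0 : 0 < n by lia.
have n2_gt0 : 0 < n.*2 by lia.
have [s s_le s_lt] := sqrtn_exists n.*2.
have s_ge : 40 <= s.
  rewrite leqNgt; apply/negP => s40.
  have : s.+1 ^ 2 <= 40 ^ 2 by rewrite leq_exp2r.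
  have -> : 40 ^ 2 = 40 * 40 by []; lia.
have s_gt2 : 2 < s by lia.
have := leq_trans (central_bin_lower n_gt0)
  (leq_mul (leqnn n.*2) (central_bin_upper s_gt2 s_lt n_gt0)).
rewrite leqNgt => /negP; apply.
have le1 : n.*2 * (n.*2 ^ s * 4 ^ (n.*2 %/ 3) *
    n.*2 ^ count prime (index_iota n.+1 n.*2.+1))
    <= n.*2 ^ (s + 4) * 4 ^ (n.*2 %/ 3).
  have -> : n.*2 ^ (s + 4) * 4 ^ (n.*2 %/ 3)
      = n.*2 * (n.*2 ^ s * 4 ^ (n.*2 %/ 3) * n.*2 ^ 3).
    rewrite expnD (expnS _ 3).
    move: (n.*2 ^ s) (4 ^ _) (n.*2 ^ 3) => u v w; nia.
  by rewrite leq_mul // leq_mul // leq_pexp2l.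
apply: leq_ltn_trans le1 _.
(* Cubing removes the division by 3. *)
rewrite -(ltn_exp2r _ _ (isT : 0 < 3)) expnMn -!expnM.
have le2 : 4 ^ (n.*2 %/ 3 * 3) <= 4 ^ n.*2.
  by rewrite leq_exp2l // leq_trunc_div.
apply: leq_ltn_trans (leq_mul (leqnn _) le2) _.
have -> : n * 3 = n + n.*2 by lia.
rewrite expnD ltn_pmul2r ?expn_gt0 //.
apply: (@leq_ltn_trans ((s.+1 ^ 6) ^ (s + 4))).
  rewrite -(expnM s.+1) (_ : 6 * _ = 2 * ((s + 4) * 3)); last by lia.
  by rewrite (expnM s.+1) leq_exp2r ?muln_gt0 ?addn_gt0 ?orbT //; apply: ltnW.
apply: (@leq_trans ((2 ^ (s - 4)) ^ (s + 4))).
  by rewrite ltn_exp2r ?pow6_lt_pow2 // addn_gt0 orbT.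
rewrite -(expnM _ _ (s + 4)) -(expnM 2 2) leq_exp2l //.
by rewrite -subn_sqr mul2n (leq_trans (leq_subr _ _)).
Qed.

(** * The primes following p, compared with 2p - 1 *)

Lemma next_prime_gt (p : nat) : p < next_prime p.
Proof. by have [] := next_primeP p. Qed.

Lemma next_prime_prime (p : nat) : prime (next_prime p).
Proof. by have [] := next_primeP p. Qed.

Lemma next_prime_le (p q : nat) : prime q -> p < q -> next_prime p <= q.
Proof. by have [_ _ h] := next_primeP p; apply: h. Qed.

Lemma prime_after3_le (p a b c : nat) : prime a -> prime b -> prime c ->
  p < a -> a < b -> b < c -> prime_after p 3 <= c.
Proof.
move=> a_pr b_pr c_pr pa ab bc; rewrite /prime_after /=.
apply: next_prime_le => //; apply: leq_ltn_trans bc.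
apply: next_prime_le => //; apply: leq_ltn_trans ab.
exact: next_prime_le.
Qed.

(** For p > 800, the interval (p - 1, 2p - 2] contains four primes, one of which is p. Smaller p are
    covered by a chain of explicit triples of primes. *)
Lemma prime_after3_lt (p : nat) : prime p -> 11 <= p ->
  prime_after p 3 < (2 * p).-1.
Proof.
move=> p_pr p_ge.
have [p_small|p_big] := leqP p 800.
  (* A triple serves all p from the preceding threshold up to a - 1, so its last prime c has to be
     below 2p - 1 already at that threshold. *)
  have W a b c : all prime [:: a; b; c] && (a < b < c) ->
      p < a -> c < (2 * p).-1 -> prime_after p 3 < (2 * p).-1.
    case/and3P=> /and4P[a_pr b_pr c_pr _] ab bc pa; apply: leq_ltn_trans.
    exact: (prime_after3_le a_pr b_pr c_pr).
  have [?|?] := ltnP p 13; first by apply: (W 13 17 19); [|lia..].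
  have [?|?] := ltnP p 17; first by apply: (W 17 19 23); [|lia..].
  have [?|?] := ltnP p 23; first by apply: (W 23 29 31); [|lia..].
  have [?|?] := ltnP p 37; first by apply: (W 37 41 43); [|lia..].
  have [?|?] := ltnP p 61; first by apply: (W 61 67 71); [|lia..].
  have [?|?] := ltnP p 107; first by apply: (W 107 109 113); [|lia..].
  have [?|?] := ltnP p 197; first by apply: (W 197 199 211); [|lia..].
  have [?|?] := ltnP p 379; first by apply: (W 379 383 389); [|lia..].
  have [?|?] := ltnP p 739; first by apply: (W 739 743 751); [|lia..].
  by apply: (W 809 811 821); [|lia..].
rewrite ltnNge; apply/negP => p3_ge.
have /four_primes_lt_double : 800 <= p.-1 by lia.
rewrite ltnNge => /negP; apply; rewrite -size_filter.
apply: (@uniq_leq_size _ _ [:: p; prime_after p 1; prime_after p 2]).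
  by rewrite filter_uniq // iota_uniq.
move=> q; rewrite mem_filter mem_index_iota => /andP[q_pr /andP[pq q2p]].
rewrite !inE; apply/or3P.
have [eqp|qp] := eqVneq q p; first by constructor 1.
have [eqp1|qp1] := eqVneq q (prime_after p 1); first by constructor 2.
have [eqp2|qp2] := eqVneq q (prime_after p 2); first by constructor 3.
have lt_step m : m < q -> q != next_prime m -> next_prime m < q.
  by move=> mq qm; rewrite ltn_neqAle eq_sym qm next_prime_le.
have p_lt : p < q by lia.
have : prime_after p 3 <= q.
  by apply: next_prime_le => //; apply: (lt_step) qp2; apply: lt_step qp1.
lia.
Qed.

Lemma prime_after1_lt (p : nat) : prime p -> 5 <= p ->
  prime_after p 1 < (2 * p).-1.
Proof.
move=> p_pr p_ge; have [p11|p11] := leqP 11 p.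
  apply: leq_ltn_trans _ (prime_after3_lt p_pr p11).
  by apply: ltnW; apply: ltn_trans (next_prime_gt _) (next_prime_gt _).
have [p7|p7] := ltnP p 7.
  by apply: (@leq_ltn_trans 7); [apply: next_prime_le|lia].
by apply: (@leq_ltn_trans 11); [apply: next_prime_le|lia].
Qed.

(** * Comparing products over sets of primes *)

Lemma prodr_count (R : pzSemiRingType) (I : Type) (r : seq I) (P : pred I)
  (c : R) : (\prod_(i <- r | P i) c = c ^+ count P r)%R.
Proof. by rewrite big_const_seq iter_mulr_1. Qed.

(** Factors common to [S] and [T] cancel; the remaining ones lie on opposite sides of the pivot [c].
    The powers of [c] make up for different sizes, and 1 <= c absorbs any slack. *)
Lemma prodr_exchange (R : numDomainType) (f : nat -> R) (c : R)
    (S T : seq nat) (d e : nat) :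
  uniq S -> uniq T -> (1 <= c)%R -> size T + d <= size S + e ->
  {in T, forall x, (0 <= f x)%R} ->
  {in S, forall x, x \notin T -> (c <= f x)%R} ->
  {in T, forall x, x \notin S -> (f x <= c)%R} ->
  ((\prod_(x <- T) f x) * c ^+ d <= (\prod_(x <- S) f x) * c ^+ e)%R.
Proof.
move=> uS uT c1 sz f0 cS cT.
have c0 : (0 <= c)%R := le_trans ler01 c1.
have ST : perm_eq [seq x <- T | x \in S] [seq x <- S | x \in T].
  apply: uniq_perm; rewrite ?filter_uniq // => x.
  by rewrite !mem_filter andbC.
have sizeE :
    count (fun x => x \notin S) T + d <= count (fun x => x \notin T) S + e.
  have /perm_size := ST; rewrite !size_filter => cE.
  have : count (fun x => x \in S) T + count (fun x => x \notin S) T = size T.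
    exact: (count_predC (mem S)).
  have : count (fun x => x \in T) S + count (fun x => x \notin T) S = size S.
    exact: (count_predC (mem T)).
  by move: cE sz; lia.
rewrite (bigID (mem S)) (bigID (mem T) predT) /= -big_filter (perm_big _ ST).
rewrite big_filter /= -!mulrA ler_wpM2l //.
  rewrite big_seq_cond; apply: prodr_ge0 => x /andP[_ xT]; exact: f0.
apply: (@le_trans _ _ (c ^+ (count (fun x => x \notin S) T + d))%R).
  rewrite exprD ler_wpM2r ?exprn_ge0 //.
  rewrite -prodr_count [leLHS]big_seq_cond [leRHS]big_seq_cond.
  by apply: ler_prod => x /andP[xT xS]; rewrite f0 ?cT.
apply: (le_trans (ler_weXn2l c1 sizeE)).
rewrite exprD ler_wpM2r ?exprn_ge0 //.
rewrite -prodr_count [leLHS]big_seq_cond [leRHS]big_seq_cond.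
by apply: ler_prod => x /andP[xS xT]; rewrite c0 cS.
Qed.

Lemma prodn_exchange (f : nat -> nat) (c : nat) (S T : seq nat) (d e : nat) :
  uniq S -> uniq T -> 0 < c -> size T + d <= size S + e ->
  {in S, forall x, x \notin T -> c <= f x} ->
  {in T, forall x, x \notin S -> f x <= c} ->
  (\prod_(x <- T) f x) * c ^ d <= (\prod_(x <- S) f x) * c ^ e.
Proof.
move=> uS uT c0 sz cS cT; rewrite -(ler_nat rat) !natrM !natr_prod !natrX.
apply: prodr_exchange => //; first by rewrite ler1n.
- by move=> x xS xT; rewrite ler_nat cS.
- by move=> x xT xS; rewrite ler_nat cT.
Qed.

Lemma totient_primes_decomp (y : nat) : 0 < y ->
  exists t, [/\ 0 < t, y = t * \prod_(q <- primes y) q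
    & totient y = t * \prod_(q <- primes y) q.-1].
Proof.
move=> y_gt0; exists (\prod_(q <- primes y) q ^ (logn q y).-1); split.
- rewrite big_seq; apply: prodn_cond_gt0 => q.
  by rewrite mem_primes expn_gt0 => /andP[/prime_gt0->].
- rewrite {1}(prod_prime_decomp y_gt0) prime_decompE big_map /= -big_split /=.
  by apply: eq_big_seq => q qy; rewrite -expnSr prednK // logn_gt0.
by rewrite totientE // big_split /= mulnC.
Qed.

(** The prime support of the product is exactly [S], so the cofactor [t] of [totient_primes_decomp]
    must be [s]. *)
Lemma totient_mul_prod_primes (s : nat) (S : seq nat) : 0 < s -> uniq S ->
  all prime S -> {subset primes s <= S} ->
  totient (s * \prod_(q <- S) q) = s * \prod_(q <- S) q.-1.
Proof.
move=> s_gt0 uS /allP prS sS.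
have S_gt0 : 0 < \prod_(q <- S) q.
  by rewrite big_seq; apply: prodn_cond_gt0 => q /prS/prime_gt0.
have mS q : prime q -> (q %| \prod_(r <- S) r) = (q \in S).
  move=> q_pr; rewrite Euclid_dvd_prod // big_has.
  apply/hasP/idP => [[r rS /=]|qS]; last by exists q => /=.
  by have r_pr := prS r rS; rewrite dvdn_prime2 // => /eqP->.
have pS : perm_eq (primes (s * \prod_(q <- S) q)) S.
  apply: uniq_perm; rewrite ?primes_uniq // => q.
  rewrite primesM //; apply/orP/idP => [[/sS//|]|qS].
    by rewrite mem_primes => /and3P[q_pr _]; rewrite mS.
  by right; rewrite mem_primes prS // S_gt0 mS // prS.
have sS_gt0 : 0 < s * \prod_(q <- S) q by rewrite muln_gt0 s_gt0.
have [t [_]] := totient_primes_decomp sS_gt0.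
by rewrite !(perm_big _ pS) /= => /eqP; rewrite eqn_pmul2r // => /eqP<-.
Qed.

Lemma N1_intro (x : nat) : 0 < x ->
  (forall y, x < y -> totient x < totient y) -> N1 x.
Proof.
move=> x_gt0 h; exists (totient x); first by exists x.
split=> // y y_gt0 yx; rewrite leqNgt; apply/negP => /h.
by rewrite ltnNge yx.
Qed.

(** * Initial segments of the primes and the ratios q / (q - 1) *)

Definition primes_le (m : nat) : seq nat := [seq q <- iota 0 m.+1 | prime q].

Lemma mem_primes_le (m q : nat) : (q \in primes_le m) = prime q && (q <= m).
Proof. by rewrite mem_filter mem_iota. Qed.

Lemma primes_le_uniq (m : nat) : uniq (primes_le m).
Proof. by rewrite filter_uniq // iota_uniq. Qed.

Definition primes_le_but (p m : nat) : seq nat :=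
  [seq q <- primes_le m | q != p].

Lemma mem_primes_le_but (p m q : nat) :
  (q \in primes_le_but p m) = [&& q != p, prime q & q <= m].
Proof. by rewrite mem_filter mem_primes_le. Qed.

Lemma primes_le_but_uniq (p m : nat) : uniq (primes_le_but p m).
Proof. by rewrite filter_uniq // primes_le_uniq. Qed.

Definition rho (q : nat) : rat := (q%:R / q.-1%:R)%R.

Lemma rho_ge1 (q : nat) : 1 < q -> (1 <= rho q)%R.
Proof.
move=> q1; rewrite /rho ler_pdivlMr; last by rewrite ltr0n; lia.
by rewrite mul1r ler_nat leq_pred.
Qed.

Lemma rho_anti (a b : nat) : 1 < a -> a <= b -> (rho b <= rho a)%R.
Proof.
move=> a1 ab; rewrite /rho ler_pdivrMr; last by rewrite ltr0n; lia.
rewrite mulrAC ler_pdivlMr; last by rewrite ltr0n; lia.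
by rewrite -!natrM ler_nat; case: a b a1 ab => [|a] [|b] //=; nia.
Qed.

(** Since m - 1 <= 2 (p - 1), 1 + 1/(p-1) <= 1 + 2/(m-1) <= (1 + 1/(m-1))^2. Thus p contributes no
    more to y / phi y than two primes up to m. *)
Lemma rho_le_sqr (p m : nat) : 1 < p -> p <= m -> m < (2 * p).-1 ->
  (rho p <= rho m ^+ 2)%R.
Proof.
move=> p1 pm mp; rewrite /rho expr_div_n.
rewrite ler_pdivrMr; last by rewrite ltr0n; lia.
rewrite mulrAC ler_pdivlMr; last by rewrite exprn_gt0 // ltr0n; lia.
rewrite -!natrX -!natrM ler_nat.
by case: p m p1 pm mp => [|p] [|m] //= *; rewrite !expnS !expn0 !muln1; nia.
Qed.

Lemma prod_rho (S : seq nat) :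
  (\prod_(q <- S) rho q = (\prod_(q <- S) q)%:R / (\prod_(q <- S) q.-1)%:R)%R.
Proof. by rewrite big_split /= prodfV !natr_prod. Qed.

Lemma prod_pred_gt0 (S : seq nat) : all prime S -> 0 < \prod_(q <- S) q.-1.
Proof.
move/allP=> prS; rewrite big_seq; apply: prodn_cond_gt0 => q /prS/prime_gt1.
by lia.
Qed.

(** Dividing the first inequality by the second cancels the cofactors [s] and [t]. *)
Lemma prod_rho_lt (B S : seq nat) (s t : nat) :
  all prime B -> all prime S ->
  s * \prod_(q <- B) q < t * \prod_(q <- S) q ->
  t * \prod_(q <- S) q.-1 <= s * \prod_(q <- B) q.-1 ->
  (\prod_(q <- B) rho q < \prod_(q <- S) rho q)%R.
Proof.
move=> /prod_pred_gt0 B0 /prod_pred_gt0 S0 lt_h le_g.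
rewrite !prod_rho ltr_pdivrMr ?ltr0n // mulrAC ltr_pdivlMr ?ltr0n //.
rewrite -!natrM ltr_nat.
move: lt_h le_g B0 S0.
move: (\prod_(q <- B) q.-1) (\prod_(q <- S) q.-1) => gB gS.
move: (\prod_(q <- B) q) (\prod_(q <- S) q) => hB hS h1 h2 h3 h4.
have t0 : 0 < t by case: t h1 {h2}.
have s0 : 0 < s by case: s h2 {h1}; nia.
have st0 : 0 < s * t by rewrite muln_gt0 s0.
rewrite -(ltn_pmul2l st0) mulnACA [ltnRHS]mulnACA mulnC [ltnRHS]mulnC.
apply: (@leq_trans ((t * gS) * (t * hS))).
  by rewrite ltn_pmul2l // muln_gt0 t0.
by nia.
Qed.

Lemma all_prime_primes_le (m : nat) : all prime (primes_le m).
Proof. exact: filter_all. Qed.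

Lemma mul_primorial_N1 (s p : nat) : prime p -> 0 < s -> s < p ->
  N1 (s * \prod_(q <- primes_le p) q).
Proof.
move=> p_pr s_gt0 sp; have p_gt1 := prime_gt1 p_pr.
have prF := all_prime_primes_le p; set F := primes_le p in prF *.
have F_gt0 : 0 < \prod_(q <- F) q.
  by rewrite big_seq; apply: prodn_cond_gt0 => q /(allP prF)/prime_gt0.
have uF : uniq F := primes_le_uniq p.
apply: N1_intro; first by rewrite muln_gt0 s_gt0.
move=> y lt_y; rewrite ltnNge; apply/negP.
rewrite totient_mul_prod_primes //; last first.
  move=> q; rewrite mem_primes mem_primes_le => /and3P[-> _ /dvdn_leq].
  by move=> /(_ s_gt0) /leq_trans -> //; apply: ltnW.
have y_gt0 : 0 < y by apply: leq_ltn_trans lt_y.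
have [t [t_gt0 yE ->]] := totient_primes_decomp y_gt0; rewrite {1}yE in lt_y.
have prS : all prime (primes y).
  by apply/allP => q; rewrite mem_primes => /andP[].
have uS := primes_uniq y; move: (primes y) prS uS lt_y => S prS uS lt_h le_g.
have lt_rho := prod_rho_lt prF prS lt_h le_g.
have S_gt q : q \in S -> q \notin F -> p < q.
  by move=> /(allP prS) q_pr; rewrite mem_primes_le q_pr -ltnNge.
have F_le q : q \in F -> q <= p by rewrite mem_primes_le => /andP[].
(* If [S] is no larger than [F], exchanging with pivot [rho p] contradicts [lt_rho]. *)
have [szS|szS] := leqP (size S) (size F).
  have := @prodr_exchange _ rho (rho p) F S 0 0 uF uS (rho_ge1 p_gt1).
  rewrite !addn0 !mulr1 => /(_ szS); rewrite leNgt lt_rho => /(_ _ _ _)/notF.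
  apply=> q.
  - by move=> /(allP prS)/prime_gt1/rho_ge1; apply: le_trans ler01.
  - move=> qF _; apply: rho_anti (F_le _ qF).
    by apply: prime_gt1; apply: (allP prF).
  - by move=> qS qF; apply: rho_anti => //; apply: ltnW; apply: S_gt.
(* If [S] is larger, the totient product grows by a factor of at least p, because q - 1 >= p for
   each prime q outside [F]; but s < p. *)
have := @prodn_exchange predn p S F 1 0 uS uF (prime_gt0 p_pr).
rewrite addn0 addn1 muln1 expn1 => /(_ szS) h.
have {h} le_p : \prod_(q <- F) q.-1 * p <= \prod_(q <- S) q.-1.
  apply: h => q; first by move=> qS qF; have := S_gt q qS qF; lia.
  by move=> /F_le qp _; apply: leq_trans (leq_pred q) qp.
have := prod_pred_gt0 prF; move: le_p le_g; clear -sp t_gt0.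
move: (\prod_(q <- F) _) (\prod_(q <- S) _) => a b *.
have : a * p <= s * a by apply: leq_trans (_ : t * b <= _); nia.
nia.
Qed.

Lemma perm_primes_le_but (p m : nat) : prime p -> p <= m ->
  perm_eq (primes_le m) (p :: primes_le_but p m).
Proof.
move=> p_pr pm; rewrite /primes_le_but -rem_filter ?primes_le_uniq //.
by apply: perm_to_rem; rewrite mem_primes_le p_pr.
Qed.

(** Exchanges with pivots at m: totients bound [S] from above, ratios from below. The hypothesis m <
    2p - 1 serves twice, for the lower bound on the size of [S] and for t = 1. *)
Lemma almost_primorial_cases (p m t : nat) (S : seq nat) :
  prime p -> 2 < p -> p <= m -> m < (2 * p).-1 -> uniq S -> all prime S ->
  0 < t ->
  \prod_(q <- primes_le_but p m) q < t * \prod_(q <- S) q ->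
  t * \prod_(q <- S) q.-1 <= \prod_(q <- primes_le_but p m) q.-1 ->
  [/\ t = 1, p \in S, size S = size (primes_le_but p m)
    & forall q, prime q -> q < p -> q \in S].
Proof.
move=> p_pr p_gt2 pm mp uS prS t_gt0.
set B := primes_le_but p m => lt_h le_g.
have p_gt1 : 1 < p by lia.
have m_gt1 : 1 < m by lia.
have uB : uniq B := primes_le_but_uniq p m.
have memB q : (q \in B) = [&& q != p, prime q & q <= m].
  exact: mem_primes_le_but.
have prB : all prime B by apply/allP => q; rewrite memB => /and3P[].
have B_gt0 := prod_pred_gt0 prB.
have lt_rho : (\prod_(q <- B) rho q < \prod_(q <- S) rho q)%R.
  by apply: (@prod_rho_lt _ _ 1 t) => //; rewrite mul1n.
have S_ge0 q : q \in S -> (0 <= rho q)%R.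
  by move=> /(allP prS)/prime_gt1/rho_ge1; apply: le_trans ler01.
have S_gt q : q \in S -> q \notin B -> q != p -> m < q.
  by move=> /(allP prS) q_pr + qp; rewrite memB q_pr qp /= -ltnNge.
have B_rho q : q \in B -> (rho m <= rho q)%R.
  by rewrite memB => /and3P[_ /prime_gt1 q1 qm]; apply: rho_anti.
have F_perm := perm_primes_le_but p_pr pm.
have F_size : size (primes_le m) = (size B).+1 by rewrite (perm_size F_perm).
have F_prod : \prod_(q <- primes_le m) q.-1 = p.-1 * \prod_(q <- B) q.-1.
  by rewrite (perm_big _ F_perm) big_cons.
(* A set of more primes than [B] has at least as many as [primes_le m], whose totient product is p -
   1 times that of [B]. *)
have g_exch (U : seq nat) : uniq U -> all prime U -> size B < size U ->
    p.-1 * \prod_(q <- B) q.-1 <= \prod_(q <- U) q.-1.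
  move=> uU prU szU.
  have := @prodn_exchange predn m U _ 0 0 uU (primes_le_uniq m) (ltnW m_gt1).
  rewrite F_size F_prod !addn0 !muln1; apply=> // q.
    move=> /(allP prU) q_pr; rewrite mem_primes_le q_pr -ltnNge /=.
    by clear; lia.
  by rewrite mem_primes_le => /andP[_ qm] _; apply: leq_trans (leq_pred q) qm.
have szS : size S <= size B.
  rewrite leqNgt; apply/negP => /(g_exch _ uS prS).
  move: le_g B_gt0; clear -p_gt2 t_gt0; nia.
(* Without p, all primes of [S] outside [B] exceed m, so the ratio product of [S] could not beat
   that of [B]. *)
have pS : p \in S.
  apply: contraLR lt_rho => pS; rewrite -leNgt.
  have := @prodr_exchange _ rho (rho m) B S 0 0 uB uS (rho_ge1 m_gt1).
  rewrite !addn0 !mulr1; apply=> // q; first by move=> qB _; apply: B_rho.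
  move=> qS qB; apply: rho_anti => //; apply: ltnW; apply: S_gt => //.
  by apply: contraNneq pS => <-.
have S_perm := perm_to_rem pS; set S' := rem p S in S_perm.
have uS' : uniq S' := rem_uniq p uS.
have S'_S q : q \in S' -> q \in S by apply: mem_rem.
have pS' q : q \in S' -> q != p by rewrite mem_rem_uniq // inE => /andP[].
have S_size : size S = (size S').+1 by rewrite (perm_size S_perm).
have S_prod : \prod_(q <- S) q.-1 = p.-1 * \prod_(q <- S') q.-1.
  by rewrite (perm_big _ S_perm) big_cons.
(* If [S] were smaller than [B], then [S'] would miss at least two elements, and by [rho_le_sqr] the
   factor [rho p] cannot make up for them. *)
have szE : size S = size B.
  apply/eqP; rewrite eqn_leq szS leqNgt; apply: contraL lt_rho => ltS.
  rewrite -leNgt (perm_big _ S_perm) big_cons /=.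
  have := @prodr_exchange _ rho (rho m) B S' 2 0 uB uS' (rho_ge1 m_gt1).
  rewrite mulr1 => h; apply: le_trans (h _ _ _ _).
  - rewrite mulrC ler_wpM2l ?rho_le_sqr // big_seq.
    by apply: prodr_ge0 => q /S'_S; apply: S_ge0.
  - by rewrite addn0 addn2 -S_size.
  - by move=> q /S'_S; apply: S_ge0.
  - by move=> q qB _; apply: B_rho.
  move=> q qS' qB; apply: rho_anti => //; apply: ltnW.
  by apply: S_gt => //; [apply: S'_S|apply: pS'].
split=> //; last first.
  (* Adding a missing q < p to [S] makes it larger than [B], so p - 1 <= q - 1 by [g_exch]. *)
  move=> q q_pr qp; apply/negPn/negP => qS.
  have := g_exch (q :: S); rewrite /= qS uS q_pr prS szE big_cons.
  move=> /(_ isT isT (ltnSn _)); rewrite leqNgt => /negP; apply.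
  apply: (@leq_ltn_trans (q.-1 * \prod_(r <- B) r.-1)).
    by rewrite leq_mul2l (leq_trans (leq_pmull _ t_gt0) le_g) orbT.
  by rewrite ltn_pmul2r //; have := prime_gt1 q_pr; clear -qp; lia.
(* Comparing [B] with [S'] and one extra factor m - 1 gives t (p - 1) <= m - 1 < 2 (p - 1), so t =
   1. *)
have := @prodn_exchange predn m.-1 S' B 0 1 uS' uB.
rewrite addn0 addn1 muln1 expn1 => h.
have {h} le_m : \prod_(q <- B) q.-1 <= \prod_(q <- S') q.-1 * m.-1.
  apply: h; [clear -m_gt1; lia|by rewrite -S_size szE| |]; move=> q.
    by move=> qS' qB; have := S_gt q (S'_S q qS') qB (pS' q qS'); clear; lia.
  by rewrite memB => /and3P[_ _ +] _; clear; lia.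
have S'_gt0 : 0 < \prod_(q <- S') q.-1.
  by apply: prod_pred_gt0; apply/allP => q /S'_S /(allP prS).
move: le_g; rewrite S_prod; move: le_m S'_gt0; clear -p_gt2 mp t_gt0.
move: (\prod_(q <- B) _) (\prod_(q <- S') _) => a b h1 h2 h3.
have : t * p.-1 * b <= m.-1 * b by nia.
rewrite leq_pmul2r // => h4; nia.
Qed.

(** * The families X and Y *)

Lemma prime_after_ge (p k : nat) : p <= prime_after p k.
Proof.
elim: k => // k IHk; apply: leq_trans IHk _; exact: ltnW (next_prime_gt _).
Qed.

Lemma perm_primes_le_next (m : nat) :
  perm_eq (primes_le (next_prime m)) (next_prime m :: primes_le m).
Proof.
apply: uniq_perm => [||q]; rewrite /= ?mem_primes_le ?primes_le_uniq //.
  by rewrite andbT next_prime_prime leqNgt next_prime_gt.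
rewrite inE mem_primes_le.
have [->|qm] := eqVneq q; first by rewrite next_prime_prime leqnn.
case q_pr: (prime q) => //=; have [qm'|mq] := leqP q m.
  exact: leq_trans qm' (ltnW (next_prime_gt m)).
by apply/negbTE; rewrite -ltnNge ltn_neqAle eq_sym qm next_prime_le.
Qed.

Lemma perm_primes_le_but_after (p k : nat) : prime p ->
  perm_eq (primes_le_but p (prime_after p k))
    (primes_le p.-1 ++ [seq prime_after p i | i <- iota 1 k]).
Proof.
move=> p_pr; elim: k => [|k IHk].
  rewrite cats0; apply: uniq_perm => [||q].
  - exact: primes_le_but_uniq.
  - exact: primes_le_uniq.
  rewrite mem_primes_le_but mem_primes_le; case: prime; rewrite ?andbF //=.
  by have := prime_gt0 p_pr; rewrite /prime_after /=; lia.
have -> : iota 1 k.+1 = iota 1 k ++ [:: k.+1].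
  by have := iotaD 1 k 1; rewrite addn1 add1n.
rewrite map_cat catA perm_sym perm_catC /= perm_sym.
rewrite -/(prime_after p k) /primes_le_but.
apply: (perm_trans (perm_filter _ (perm_primes_le_next _))) => /=.
rewrite gtn_eqF; last first.
  exact: leq_ltn_trans (prime_after_ge p k) (next_prime_gt _).
by rewrite /= perm_cons.
Qed.

Lemma Y_prod (p k : nat) :
  Y p k = \prod_(q <- primes_le_but p (prime_after p k)) q.
Proof.
rewrite /Y -(big_mkord (fun q => prime q && (q != p)) id) /primes_le_but.
rewrite /primes_le -filter_predI big_filter /index_iota subn0.
by apply: eq_bigl => q /=; rewrite andbC.
Qed.

(* A counterexample to [N1 (Y p k)] would be squarefree and obtained by trading
   the primes p_1, ..., p_k for p and k - 1 larger primes. *)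
Lemma Y_N1 (p k : nat) : prime p -> 2 < p -> prime_after p k < (2 * p).-1 ->
  (forall R : seq nat, uniq R -> {in R, forall q, prime q /\ p < q} ->
    (size R).+1 = k ->
    \prod_(i <- iota 1 k) prime_after p i < p * \prod_(q <- R) q ->
    p.-1 * \prod_(q <- R) q.-1 <= \prod_(i <- iota 1 k) (prime_after p i).-1 ->
    False) ->
  N1 (Y p k).
Proof.
move=> p_pr p_gt2 m_lt noR; rewrite Y_prod.
have B_perm := perm_primes_le_but_after k p_pr.
set B := primes_le_but p _ in B_perm *.
have prB : all prime B.
  by apply/allP => q; rewrite mem_primes_le_but => /and3P[].
have uB : uniq B := primes_le_but_uniq _ _.
have B_gt0 : 0 < \prod_(q <- B) q.
  by rewrite big_seq; apply: prodn_cond_gt0 => q /(allP prB)/prime_gt0.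
apply: N1_intro => // y lt_y; rewrite ltnNge; apply/negP.
have -> : totient (\prod_(q <- B) q) = \prod_(q <- B) q.-1.
  by have := @totient_mul_prod_primes 1 B isT uB prB; rewrite !mul1n; apply.
have y_gt0 : 0 < y by apply: leq_ltn_trans lt_y.
have [t [t_gt0 yE ->]] := totient_primes_decomp y_gt0; rewrite {1}yE in lt_y.
have prS : all prime (primes y).
  by apply/allP => q; rewrite mem_primes => /andP[].
have uS := primes_uniq y; move: (primes y) prS uS lt_y => S prS uS lt_h le_g.
have [t1 pS szS QS] := almost_primorial_cases p_pr p_gt2 (prime_after_ge p k)
  m_lt uS prS t_gt0 lt_h le_g.
move: lt_h le_g; rewrite t1 !mul1n -/B => lt_h le_g.
(* [S] consists of all primes below p, p itself and [R]; the primes below p also lie in [B] and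
   cancel from both inequalities. *)
pose R := [seq q <- S | p < q].
have uR : uniq R by rewrite filter_uniq.
have S_perm : perm_eq S (primes_le p.-1 ++ p :: R).
  apply: uniq_perm => // [|q].
    have pR : p \notin R by rewrite mem_filter ltnn.
    have pQ : p \notin primes_le p.-1 by rewrite mem_primes_le p_pr /=; lia.
    rewrite cat_uniq primes_le_uniq /= uR pR negb_or pQ !andbT /=.
    apply/hasPn => q; rewrite mem_filter => /andP[pq _].
    rewrite mem_primes_le negb_and -ltnNge orbC.
    by rewrite (leq_ltn_trans (leq_pred p) pq).
  rewrite mem_cat inE [q \in R]mem_filter mem_primes_le.
  apply/idP/or3P => [qS|].
    have q_pr := allP prS _ qS; case: (ltngtP q p) => qp.
    - by constructor 1; rewrite q_pr; lia.
    - by constructor 3; rewrite qS.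
    - by constructor 2.
  case=> [/andP[q_pr qp]|/eqP->|/andP[]] //; apply: QS => //.
  by have := prime_gt0 p_pr; lia.
have Q_gt0 : 0 < \prod_(q <- primes_le p.-1) q.
  rewrite big_seq; apply: prodn_cond_gt0 => q.
  by rewrite mem_primes_le => /andP[/prime_gt0].
have Q'_gt0 := prod_pred_gt0 (all_prime_primes_le p.-1).
move: lt_h le_g; rewrite !(perm_big _ B_perm) !(perm_big _ S_perm) /=.
rewrite !big_cat !big_cons /= !big_map ltn_pmul2l // leq_pmul2l //.
apply: noR => // [q|].
  by rewrite mem_filter => /andP[pq /(allP prS)].
have := szS; rewrite -/B (perm_size B_perm) (perm_size S_perm) !size_cat.
by rewrite size_map size_iota => /eqP; rewrite eqn_add2l => /eqP.
Qed.

(** The cofactor n / rad n is below p: for n > 1 because rad n >= 2 and n < 2p, and for n = 1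
    trivially. *)
Lemma X_N1 (n p : nat) : prime p -> 0 < n -> n < 2 * p -> N1 (X n p).
Proof.
move=> p_pr n_gt0 np; have p_gt1 := prime_gt1 p_pr.
rewrite /X -(big_mkord prime (fun q => q)) -[X in _ * X]big_filter.
rewrite /index_iota subn0 -/(primes_le p).
have rad_n := prod_primes_dvd n_gt0.
have rad_gt0 : 0 < \prod_(q <- primes n) q by apply: dvdn_gt0 rad_n.
apply: mul_primorial_N1 => //; first by rewrite divn_gt0 // dvdn_leq.
rewrite ltn_divLR //; case: (ltnP 1 n) => [n_gt1|n1]; last first.
  by apply: (@leq_trans p); [lia|rewrite leq_pmulr].
rewrite mulnC; apply: leq_trans np _; rewrite leq_mul2r.
rewrite (big_rem (pdiv n)) /=; last first.
  by rewrite mem_primes pdiv_prime // n_gt0 pdiv_dvd.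
have pd2 := prime_gt1 (pdiv_prime n_gt1).
rewrite (leq_trans pd2) ?orbT // leq_pmulr // big_seq.
by apply: prodn_cond_gt0 => q /mem_rem; rewrite mem_primes => /andP[/prime_gt0].
Qed.

(** * Unboundedness, and the interval conditions of E(2) and E(3) *)

Lemma leq_prod_seq (S : seq nat) (q : nat) :
  {in S, forall r, 0 < r} -> q \in S -> q <= \prod_(r <- S) r.
Proof.
move=> S0 qS; rewrite (big_rem q) //= leq_pmulr // big_seq.
by apply: prodn_cond_gt0 => r /mem_rem /S0.
Qed.

Lemma unbounded_infinite_set (E : set nat) :
  (forall m, exists2 x, E x & m < x) -> infinite_set E.
Proof.
move=> E_unb /finite_seqP[s sE].
have [x Ex] := E_unb (\max_(i <- s) i).
have xs : x \in s by move: Ex; rewrite sE.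
by rewrite ltnNge (@leq_bigmax_seq _ s predT id x xs isT).
Qed.

(** Rests on A(p) + D(p) = 1 + (p_1 - 1)(p_2 - 1)/(p - 1). With denominators cleared, the conditions
    are those that [Y_N1] has to refute for k = 2 and R = {r}. *)
Lemma E2_itvE (p r : nat) : 1 < p -> 0 < r ->
  nat_itv_oc (A p) (A p + D p) r <->
  prime_after p 1 * prime_after p 2 < p * r /\
  p.-1 * r.-1 <= (prime_after p 1).-1 * (prime_after p 2).-1.
Proof.
move=> p_gt1 r_gt0; rewrite /nat_itv_oc /mkset /A /D.
have h1 := leq_trans p_gt1 (prime_after_ge p 1).
have h2 := leq_trans p_gt1 (prime_after_ge p 2).
move: (prime_after p 1) (prime_after p 2) h1 h2 => a b a_gt1 b_gt1.
have p0 : (0 < p%:R :> rat)%R by rewrite ltr0n; lia.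
have p1 : (0 < p.-1%:R :> rat)%R by rewrite ltr0n; lia.
have predE n : 0 < n -> (n.-1%:R = n%:R - 1 :> rat)%R.
  by move=> n0; rewrite -[n in RHS]prednK // -natr1 addrK.
have -> : (a%:R * b%:R / p%:R
    + (a%:R - p%:R) * (b%:R - p%:R) / (p%:R * (p%:R - 1))
    = 1 + a.-1%:R * b.-1%:R / p.-1%:R :> rat)%R.
  have p1' : (p%:R - 1 != 0 :> rat)%R by rewrite -predE ?gt_eqF //; lia.
  rewrite !predE; try lia; field; rewrite p1' gt_eqF //.
rewrite ltr_pdivrMr // -lerBlDl -predE // ler_pdivlMr //.
rewrite -!natrM ltr_nat ler_nat [r * _]mulnC [r.-1 * _]mulnC.
by split=> [/andP[]|[-> ->]].
Qed.

(** The counterpart for k = 3 and R = {q, r}. *)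
Lemma E3_itvE (p q r : nat) : 1 < p -> 1 < q -> 0 < r ->
  nat_itv_oc (E3_lower p q) (E3_upper p q) r <->
  prime_after p 1 * prime_after p 2 * prime_after p 3 < p * q * r /\
  p.-1 * q.-1 * r.-1
    <= (prime_after p 1).-1 * (prime_after p 2).-1 * (prime_after p 3).-1.
Proof.
move=> p_gt1 q_gt1 r_gt0; rewrite /nat_itv_oc /mkset /E3_lower /E3_upper.
have h1 := leq_trans p_gt1 (prime_after_ge p 1).
have h2 := leq_trans p_gt1 (prime_after_ge p 2).
have h3 := leq_trans p_gt1 (prime_after_ge p 3).
move: (prime_after p 1) (prime_after p 2) (prime_after p 3) h1 h2 h3.
move=> a b c a_gt1 b_gt1 c_gt1.
have predE n : 0 < n -> (n%:R - 1 = n.-1%:R :> rat)%R.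
  by move=> n0; rewrite -[n in LHS]prednK // -natr1 addrK.
rewrite !predE; try lia.
rewrite ltr_pdivrMr; last by rewrite -natrM ltr0n muln_gt0; lia.
rewrite -lerBlDl predE // ler_pdivlMr; last first.
  by rewrite -natrM ltr0n muln_gt0; lia.
rewrite -!natrM ltr_nat ler_nat [r * _]mulnC [r.-1 * _]mulnC.
by split=> [/andP[]|[-> ->]].
Qed.

Lemma next_primeE (p q : nat) : prime q -> p < q ->
  ~~ has prime (iota p.+1 (q - p.+1)) -> next_prime p = q.
Proof.
move=> q_pr pq /hasPn no; apply/eqP; rewrite eqn_leq next_prime_le //=.
rewrite leqNgt; apply/negP => lt_q.
by have := no (next_prime p); rewrite mem_iota next_prime_gt subnKC // lt_q
  next_prime_prime => /(_ isT).
Qed.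

Lemma prime_after_11 :
  [/\ prime_after 11 1 = 13, prime_after 11 2 = 17 & prime_after 11 3 = 19].
Proof.
rewrite /prime_after /=.
have -> : next_prime 11 = 13 by apply: next_primeE.
have -> : next_prime 13 = 17 by apply: next_primeE.
by have -> : next_prime 17 = 19 by apply: next_primeE.
Qed.

Lemma E2_11 : E2 11.
Proof.
split=> //; apply/seteqP; split=> // r [+ /= r_pr].
rewrite E2_itvE ?prime_gt0 //; have [-> -> _] := prime_after_11.
move=> [h1 h2]; have r_gt0 := prime_gt0 r_pr.
(* 221 < 11 r forces r >= 21, while 10 (r - 1) <= 192 forces r <= 20. *)
by move: h1 h2 => /=; lia.
Qed.

Lemma E3_11 : E3 11.
Proof.
split=> // q [q_pr q_gt]; apply/seteqP; split=> // r [+ [r_pr qr]].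
rewrite E3_itvE ?prime_gt0 ?prime_gt1 //; have [-> -> ->] := prime_after_11.
have -> : 13 * 17 * 19 = 4199 by [].
have -> : 13.-1 * 17.-1 * 19.-1 = 3456 by [].
(* As q < r, the bound 10 (q - 1)(r - 1) <= 3456 gives q (q - 1) <= 345. Only q = 13, 17, 19 remain,
   and each leaves no integer r. *)
move=> [h1 h2]; have q_le : q < 20 by nia.
have : q \in iota 12 8 by rewrite mem_iota; lia.
by rewrite !inE => /or4P[||| /or4P[|||/orP[]]] /eqP qE; subst q => //;
  move: h1 h2 => /=; lia.
Qed.

Lemma Y1_N1 (p : nat) : prime p -> 5 <= p -> N1 (Y p 1).
Proof.
move=> p_pr p_ge; apply: Y_N1 => //; first by lia.
  exact: prime_after1_lt.
(* For k = 1 the list [R] is empty, and p_1 < p would follow. *)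
case=> // _ _ _; rewrite /= big_seq1 big_nil muln1 ltnNge.
by rewrite prime_after_ge.
Qed.

Lemma Y2_N1 (p : nat) : E2 p -> 11 <= p -> N1 (Y p 2).
Proof.
move=> [p_pr E] p_ge; apply: Y_N1 => //; first by lia.
  apply: leq_ltn_trans (prime_after3_lt p_pr p_ge).
  exact: ltnW (next_prime_gt _).
move=> [|r [|? ?]] // _ R_pr _; have [r_pr pr] := R_pr r (mem_head _ _).
rewrite /= !big_cons !big_nil !muln1 => h1 h2.
rewrite -[False]/(set0 r) -E; split=> //.
by apply/E2_itvE => //; [exact: prime_gt1|exact: prime_gt0].
Qed.

Lemma Y3_N1 (p : nat) : E3 p -> 11 <= p -> N1 (Y p 3).
Proof.
move=> [p_pr E] p_ge; apply: Y_N1 => //; first by lia.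
  exact: prime_after3_lt.
(* E(3) only speaks of r > q, so the two elements of [R] have to be put in order first. *)
have no q r : prime q -> prime r -> p < q -> q < r ->
    prime_after p 1 * prime_after p 2 * prime_after p 3 < p * q * r ->
    p.-1 * q.-1 * r.-1 <=
      (prime_after p 1).-1 * (prime_after p 2).-1 * (prime_after p 3).-1 ->
    False.
  move=> q_pr r_pr pq qr h1 h2; rewrite -[False]/(set0 r).
  rewrite -(E q (conj q_pr pq)); split=> //.
  by apply/E3_itvE => //; [exact: prime_gt1|exact: prime_gt1|exact: prime_gt0].
move=> [|q [|r [|? ?]]] // + R_pr _; rewrite /= andbT inE => qr.
have [q_pr pq] : prime q /\ p < q by apply: R_pr; rewrite inE eqxx.
have [r_pr pr] : prime r /\ p < r by apply: R_pr; rewrite !inE eqxx orbT.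
rewrite !big_cons !big_nil !muln1 !mulnA => h1 h2.
case: (ltngtP q r) => [lt_qr|lt_rq|eq_qr]; first exact: (no q r).
  by apply: (no r q); rewrite // ?[p * r * q]mulnAC ?[p.-1 * r.-1 * _]mulnAC.
by rewrite eq_qr eqxx in qr.
Qed.

Theorem theorem2 :
  [/\ infinite_set calX /\ calX `<=` N1,
      infinite_set calY1 /\ calY1 `<=` N1,
      calY2 !=set0 /\ calY2 `<=` N1
    & calY3 !=set0 /\ calY3 `<=` N1].
Proof.
split; split.
- apply: unbounded_infinite_set => m; have [p mp p_pr] := prime_above m.
  (* X_{1,p} is the primorial of p, hence at least p. *)
  exists (X 1 p); first by exists 1, p; split=> //; have := prime_gt1 p_pr; lia.
  apply: leq_trans mp _.
  rewrite /X big_nil mul1n -(big_mkord prime (fun q => q)) -big_filter.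
  apply: leq_prod_seq => [q|]; rewrite mem_filter.
    by case/andP=> /prime_gt0.
  by rewrite p_pr mem_index_iota ltnS leqnn.
- by move=> _ [n [p [n_gt0 p_pr np ->]]]; apply: X_N1.
- apply: unbounded_infinite_set => m.
  have [p mp p_pr] := prime_above (m + 5).
  exists (Y p 1); first by exists p; split=> //; lia.
  (* Y_{p,1} has p_1 > p among its factors. *)
  apply: (@leq_trans p); first by lia.
  apply: leq_trans (prime_after_ge p 1) _; rewrite Y_prod; apply: leq_prod_seq.
    by move=> q; rewrite mem_primes_le_but => /and3P[_ /prime_gt0].
  rewrite mem_primes_le_but leqnn andbT gtn_eqF ?next_prime_gt //=.
  exact: next_prime_prime.
- by move=> _ [p [p_pr p_ge ->]]; apply: Y1_N1.
- by exists (Y 11 2); exists 11; split=> //; apply: E2_11.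
- by move=> _ [p [p_E p_ge ->]]; apply: Y2_N1.
- by exists (Y 11 3); exists 11; split=> //; apply: E3_11.
- by move=> _ [p [p_E p_ge ->]]; apply: Y3_N1.
Qed.
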